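(* Let $\varphi$ be a rational inner function on $\mathbb{D}^2$ of the form $\varphi(z_1,z_2)=\frac{\tilde p(z_1,z_2)}{p(z_1,z_2)}$, where $p\in\mathbb{C}[z_1,z_2]$ has no zeros on $\mathbb{D}^2$ and has a single zero $\tau$ on $\mathbb{T}^2$, and let $\Phi=(\varphi,\varphi)\in\mathcal{O}(\mathbb{D}^2,\mathbb{D}^2)$. Suppose that there exist an exponent $q>1$, a constant $C>0$ and a neighborhood $\mathcal{U}$ of $\tau$ such that $$|p(z)|\ge C\,\mathrm{dist}^q(z,\mathcal{Z}_p)\qquad\text{for all } z\in\overline{\mathbb{D}^2\cap\mathcal{U}}.$$ Then the composition operator $C_\Phi: A^2(\mathbb{D}^2)\to A^2(\mathbb{D}^2)$ is not bounded.
   Context: $\mathbb{D}^2=\{(z_1,z_2)\in\mathbb{C}^2:|z_1|<1,|z_2|<1\}$ is the bidisc and $\mathbb{T}^2=\{(\zeta_1,\zeta_2)\in\mathbb{C}^2:|\zeta_1|=|\zeta_2|=1\}$ its distinguished boundary. $\mathcal{O}(\Omega_1,\Omega_2)$ is the class of holomorphic maps $\Omega_1\to\Omega_2$. A rational inner function (RIF) on $\mathbb{D}^2$ is a rational function, holomorphic on $\mathbb{D}^2$ with values in $\mathbb{D}$, whose boundary values have modulus $1$ almost everywhere on $\mathbb{T}^2$. For $p\in\mathbb{C}[z_1,z_2]$ of bidegree $(n,m)$, the reflection is $\tilde p(z)=z_1^nz_2^m\overline{p(1/\overline{z_1},1/\overline{z_2})}$. $\mathcal{Z}_p$ is the zero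 set of $p$ and $\mathrm{dist}(z,\mathcal{Z}_p)$ is the Euclidean distance from $z$ to $\mathcal{Z}_p$; $\mathrm{dist}^q$ denotes its $q$-th power. $A^2(\mathbb{D}^2)$ is the (unweighted) Bergman space of holomorphic $f:\mathbb{D}^2\to\mathbb{C}$ with $\int_{\mathbb{D}^2}|f(z_1,z_2)|^2\,dA(z_1)dA(z_2)<\infty$, with the norm given by the square root of this integral, where $dA=\frac1\pi dx\,dy$. The composition operator is $C_\Phi f=f\circ\Phi$. ''$C_\Phi:X\to Y$ is bounded'' means that $C_\Phi$ maps $X$ into $Y$ and is a bounded linear operator. *)

(* Defs.v *)
From HB Require Import structures.
From mathcomp Require Import all_boot all_order all_algebra polyXY complex.
From mathcomp Require Import all_classical all_reals all_analysis.
Import Order.TTheory GRing.Theory Num.Theory numFieldNormedType.Exports.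
Import ComplexField.Normc.

Set Implicit Arguments.
Unset Strict Implicit.
Unset Printing Implicit Defensive.

Local Open Scope classical_set_scope.
Local Open Scope ring_scope.

Section Bidisc.
Variable R : realType.
(* R[i] carries its topology and its normed-module structure over itself only
   through the alias R[i]^o. *)
Local Notation C := R[i]^o.
Local Notation C2 := (C * C)%type.

(* The real-valued modulus normc is used throughout: the library norm `|z| of
   R[i] takes its values in R[i]. *)
Definition bidisc : set C2 := [set z | normc z.1 < 1 /\ normc z.2 < 1].

Definition torus : set C2 := [set z | normc z.1 = 1 /\ normc z.2 = 1].

Definition edist2 (z w : C2) : R :=
  Num.sqrt (normc (z.1 - w.1) ^+ 2 + normc (z.2 - w.2) ^+ 2).

Definition edist2_set (z : C2) (A : set C2) : R := inf [set edist2 z w | w in A].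

(* differentiable is Frechet differentiability over the scalar field R[i], so
   the differential is C-linear. *)
Definition holomorphic_on (D : set C2) (f : C2 -> C) : Prop :=
  forall z, D z -> differentiable f z.

(* A polynomial in z1, z2 is an element of {poly {poly R[i]}} whose outer
   variable is z1 and whose inner variable is z2. *)
Definition peval (p : {poly {poly R[i]}}) (z : C2) : C := p.[z.1, z.2].

Definition pzeros (p : {poly {poly R[i]}}) : set C2 := [set z | peval p z = 0].

Definition deg1 (p : {poly {poly R[i]}}) : nat := (size p).-1.
Definition deg2 (p : {poly {poly R[i]}}) : nat := (sizeY p).-1.

(* Given by its coefficients, so as to be defined also where z1 z2 = 0; lemma
   reflectionE is the formula z1^n z2^m conj (p (1 / conj z1, 1 / conj z2)). *)
Definition reflection (p : {poly {poly R[i]}}) : {poly {poly R[i]}} :=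
  \poly_(i < (deg1 p).+1) \poly_(j < (deg2 p).+1)
    conjc (p`_(deg1 p - i)`_(deg2 p - j)).

(* t |-> (cis t.1, cis t.2) parametrizes the torus; since it is 2 pi-periodic,
   null sets of angles in R * R correspond to null sets of the torus. *)
Definition cis (t : R) : C := (cos t +i* sin t)%C.

Definition unimodular_boundary_values (phi : C2 -> C) : Prop :=
  {ae (@lebesgue_measure R \x @lebesgue_measure R)%E, forall t : R * R,
    exists2 w : C, normc w = 1 &
      (fun r : R => phi ((r%:C)%C * cis t.1, (r%:C)%C * cis t.2)) @ 1^'- --> w}.

Definition rational_on (D : set C2) (phi : C2 -> C) : Prop :=
  exists a b : {poly {poly R[i]}}, b != 0 /\
    forall z, D z -> peval b z != 0 -> phi z = peval a z / peval b z.

Definition rational_inner (phi : C2 -> C) : Prop :=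
  [/\ rational_on bidisc phi,
      holomorphic_on bidisc phi,
      (forall z, bidisc z -> normc (phi z) < 1) &
      unimodular_boundary_values phi].

Lemma invpi_ge0 : 0 <= (pi : R)^-1.
Proof. by rewrite invr_ge0 pi_ge0. Qed.

Definition dA : set (measurableTypeR R * measurableTypeR R) -> \bar R :=
  mscale (NngNum invpi_ge0) (@lebesgue_measure R \x @lebesgue_measure R)%E.

HB.instance Definition _ := Measure.on dA.

(* Needed because the library's sigma-finite instance on m1 \x m2 is not inferred
   for two sigma-finite measures; Fubini on dA \x dA uses it. *)
Lemma dA_sigma_finite : sigma_finite setT dA.
Proof.
have /sigma_finiteP[F [TF ndF Foo]] := sigma_finiteT (@lebesgue_measure R).
exists (fun n => F n `*` F n).
  rewrite -setXTT TF predeqE => -[x y]; split.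
    move=> [/= [n _ Fnx] [k _ Fky]]; exists (maxn n k) => //; split.
    - by move: x Fnx; exact/subsetPset/ndF/leq_maxl.
    - by move: y Fky; exact/subsetPset/ndF/leq_maxr.
  by move=> [n _ []/= ? ?]; split; exists n.
move=> k; have [mFk Fkoo] := Foo k.
split; first exact: measurableX.
rewrite /dA /mscale /= product_measure1E//.
have muF : lebesgue_measure (F k) \is a fin_num by rewrite ge0_fin_numE.
by rewrite -ge0_fin_numE ?fin_numM// !mule_ge0// lee_fin invpi_ge0.
Qed.

HB.instance Definition _ :=
  Measure_isSigmaFinite.Build _ _ _ dA dA_sigma_finite.

Definition of_coords (w : (R * R) * (R * R)) : C2 :=
  ((w.1.1 +i* w.1.2)%C, (w.2.1 +i* w.2.2)%C).

Definition A2_sqnorm (f : C2 -> C) : \bar R :=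
  (\int[dA \x dA]_(w in of_coords @^-1` bidisc)
     (normc (f (of_coords w)) ^+ 2)%:E)%E.

(* Elements of A^2 are represented by total functions on C^2, of which only the
   restriction to the bidisc is relevant. *)
Definition A2 (f : C2 -> C) : Prop :=
  holomorphic_on bidisc f /\ (A2_sqnorm f < +oo)%E.

Definition A2_norm (f : C2 -> C) : R := Num.sqrt (fine (A2_sqnorm f)).

Definition bounded_on_A2 (T : (C2 -> C) -> (C2 -> C)) : Prop :=
  [/\ forall f, A2 f -> A2 (T f),
      (forall (a : C) f g, A2 f -> A2 g ->
        forall z, bidisc z ->
          T (fun w => a * f w + g w) z = a * T f z + T g z) &
      exists M : R, forall f, A2 f -> A2_norm (T f) <= M * A2_norm f].

Definition comp_op (Phi : C2 -> C2) (f : C2 -> C) : C2 -> C := f \o Phi.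

Lemma reflectionE (p : {poly {poly R[i]}}) (z : C2) : z.1 != 0 -> z.2 != 0 ->
  peval (reflection p) z =
  z.1 ^+ deg1 p * z.2 ^+ deg2 p *
    conjc (peval p ((conjc z.1)^-1, (conjc z.2)^-1)).
Proof.
case: z => x y /= x0 y0.
have szp : (size p <= (deg1 p).+1)%N by exact: leqSpred.
have szpi i : (size (p`_i)%R <= (deg2 p).+1)%N.
  have [lip|lpi] := ltnP i (size p); last by rewrite nth_default// size_poly0.
  apply: leq_trans (leqSpred _).
  by rewrite /sizeY (leq_bigmax (Ordinal lip)).
rewrite /peval /reflection horner_poly (horner_coef_wide _ szp) !horner_sum.
rewrite rmorph_sum mulr_sumr [RHS](reindex_inj rev_ord_inj) /=.
apply: eq_bigr => i _; rewrite subSS !hornerM -!rmorphXn /= !hornerC.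
rewrite horner_poly (horner_coef_wide _ (szpi _)) rmorphM rmorph_sum /=.
rewrite !mulr_suml mulr_sumr [RHS](reindex_inj rev_ord_inj) /=.
apply: eq_bigr => j _; rewrite subSS !rmorphM !rmorphXn !fmorphV /= !conjcK.
have expB (w : R[i]) n (k : 'I_n.+1) : w != 0 -> w ^+ n * w^-1 ^+ (n - k) = w ^+ k.
  move=> w0; rewrite -{1}(@subnK k n) -1?ltnS//.
  by rewrite exprVn exprD mulrAC divff ?mul1r// expf_neq0.
rewrite -(expB x _ i x0) -(expB y _ j y0).
have mulE (a u u' v v' : R[i]) : a * (v * v') * (u * u') = u * v * (a * v' * u').
  by rewrite [u * v]mulrC -[a * v' * u']mulrA [RHS]mulrCA [in RHS]mulrACA -[LHS]mulrA.
exact: mulE.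
Qed.

End Bidisc.

(* Main.v *)
Require Import Defs.
From HB Require Import structures.
From mathcomp Require Import all_boot all_order all_algebra polyXY complex.
From mathcomp Require Import all_classical all_reals all_analysis.
From mathcomp Require Import measurable_realfun ring lra.
Import Order.TTheory GRing.Theory Num.Theory numFieldNormedType.Exports.
Import ComplexField.Normc.

Set Implicit Arguments.
Unset Strict Implicit.
Unset Printing Implicit Defensive.

Local Open Scope classical_set_scope.
Local Open Scope ring_scope.

(** Evaluating [f (phi, phi)] only sees [f] on the diagonal of the bidisc, and
    the Bergman norm of a function of two variables does not control its
    restriction to the diagonal well enough: some functions are large all along
    the diagonal up to the boundary and small elsewhere.  The functions used
    here are [f_N (w) = ((w1 + w2) / 2) ^ N], for which [f_N (phi, phi)] is just
    [phi ^ N], and the two squared norms are compared as [N] grows.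

    Upper bound.  By the parallelogram identity, [|(w1 + w2) / 2|^2] is
    [(|w1|^2 + |w2|^2) / 2 - |w1 - w2|^2 / 4].  Hence [|f_N|^2] is at most
    [(1 - s^2) ^ N], except where [w1] and [w2] both lie within distance of order
    [s^2] of the circle and within [2 s] of each other.  An annulus of width of
    order [s^2] has area of order [s^2], and the part of it in a square of side
    of order [s] has area of order [s^3] ([area_shell_le]), so this exceptional
    set has volume of order [s^5].  Taking [s] a little larger than [N^(-1/2)]
    makes the squared norm of [f_N] nearly [N^(-5/2)], and in any case
    negligible against [N^(-2)] ([A2_sqnorm_midpoint_power_decay]).

    Lower bound.  On the torus [|p~| = |p|], where [p~] is the reflection of [p],
    so [phi] has modulus 1 there wherever [p] does not vanish.  Since [p] and
    [p~] are Lipschitz, near a point of the torus with [p <> 0] one has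
    [|phi (z)| >= 1 - L d] as soon as both coordinates of [z] are within [d] of
    the circle.  The points in question fill a volume of order [d^2], and with
    [d] of order [1 / N] the function [|phi|^(2 N)] is at least 1/2 on them.
    Hence the squared norm of [phi ^ N] is at least [c N^(-2)]
    ([A2_sqnorm_quotient_power_ge]).

    A bounded composition operator would make the second quantity at most a
    constant times the first, which is impossible for large [N]. *)

(** * Integrals of nonnegative functions and product measures *)

(** The integral of a nonnegative function is a supremum over the simple
    functions below it, hence monotone for arbitrary functions.  This allows
    [phi] and the test functions to be integrated without proving them
    measurable. *)
Lemma ge0_le_integralT d (T : measurableType d) (R : realType)
    (mu : {measure set T -> \bar R}) (f g : T -> \bar R) :
  (forall x, 0 <= f x)%E -> (forall x, f x <= g x)%E ->
  (\int[mu]_x f x <= \int[mu]_x g x)%E.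
Proof.
move=> f0 fg; have g0 x : (0 <= g x)%E := le_trans (f0 x) (fg x).
rewrite !ge0_integralTE//; apply: le_ereal_sup => _ [h hf <-].
by exists h => // x; exact: le_trans (hf x) (fg x).
Qed.

Lemma ge_integral_indic d (T : measurableType d) (R : realType)
    (mu : {measure set T -> \bar R}) (D A : set T) (f : T -> \bar R) (c : R) :
  measurable A -> A `<=` D -> 0 <= c -> (forall x, D x -> 0 <= f x)%E ->
  (forall x, A x -> c%:E <= f x)%E ->
  (c%:E * mu A <= \int[mu]_(x in D) f x)%E.
Proof.
move=> mA AD c0 f0 cf; rewrite integral_mkcond -(setIT A) -integral_indic//.
rewrite -ge0_integralZl_EFin//; last exact/measurable_EFinP.
apply: ge0_le_integralT => x.
  by rewrite mule_ge0// lee_fin.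
rewrite indicE patchE; have [/set_mem xA|xA] := boolP (x \in A); last first.
  by rewrite mule0; case: ifPn => // /set_mem/f0.
by rewrite mem_set ?mule1 ?cf//; exact: AD.
Qed.

Lemma measurable_ltr d (T : measurableType d) (R : realType) (f g : T -> R) :
  measurable_fun setT f -> measurable_fun setT g ->
  measurable [set x | f x < g x].
Proof.
move=> mf mg; have := measurable_fun_ltr mf mg.
move=> /(_ measurableT [set true]); rewrite setTI => H.
by apply: H.
Qed.

Lemma integral_le_cst_supp d (T : measurableType d) (R : realType)
    (mu : {measure set T -> \bar R}) (J : set T) (f : T -> \bar R) (K : R) :
  measurable J -> 0 <= K -> (forall x, 0 <= f x)%E ->
  (forall x, J x -> f x <= K%:E)%E -> (forall x, ~ J x -> f x = 0%E) ->
  (\int[mu]_x f x <= K%:E * mu J)%E.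
Proof.
move=> mJ K0 f0 fK fJ; rewrite -(setIT J) -integral_indic//.
rewrite -ge0_integralZl_EFin//; last exact/measurable_EFinP.
apply: ge0_le_integralT => x //; rewrite indicE.
have [/set_mem xJ|xJ] := boolP (x \in J); first by rewrite mule1 fK.
by rewrite mule0 fJ// => /mem_set; rewrite (negbTE xJ).
Qed.

Section sections.
Context d1 d2 (T1 : measurableType d1) (T2 : measurableType d2) (R : realType).
Variables (m1 : {measure set T1 -> \bar R}).
Variables (m2 : {sigma_finite_measure set T2 -> \bar R}).
Local Open Scope ereal_scope.

Lemma product_measure_le_xsection (A : set (T1 * T2)) (J : set T1) (K : R) :
  measurable J -> (0 <= K)%R -> (forall x y, A (x, y) -> J x) ->
  (forall x, J x -> m2 (xsection A x) <= K%:E) ->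
  (m1 \x m2) A <= K%:E * m1 J.
Proof.
move=> mJ K0 AJ AK; apply: integral_le_cst_supp => //= x xJ.
rewrite (_ : xsection A x = set0) ?measure0//.
by apply/seteqP; split => // y; rewrite /xsection/= => /set_mem /AJ.
Qed.

Lemma product_measure_ge_xsection (A : set (T1 * T2)) (J : set T1) (K : R) :
  measurable J -> (0 <= K)%R ->
  (forall x, J x -> K%:E <= m2 (xsection A x)) ->
  K%:E * m1 J <= (m1 \x m2) A.
Proof. by move=> mJ K0 AK; apply: ge_integral_indic. Qed.
End sections.

(** By Tonelli, the sections in the other direction bound the product measure
    as well. *)
Lemma product_measure_le_ysection d1 d2 (T1 : measurableType d1)
    (T2 : measurableType d2) (R : realType)
    (m1 : {sigma_finite_measure set T1 -> \bar R})
    (m2 : {sigma_finite_measure set T2 -> \bar R})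
    (A : set (T1 * T2)) (J : set T2) (K : R) :
  measurable A -> measurable J -> 0 <= K ->
  (forall x y, A (x, y) -> J y) ->
  (forall y, J y -> m1 (ysection A y) <= K%:E)%E ->
  ((m1 \x m2) A <= K%:E * m2 J)%E.
Proof.
move=> mA mJ K0 AJ AK.
have := indic_fubini_tonelli m1 m2 mA.
rewrite indic_fubini_tonelli_FE// indic_fubini_tonelli_GE// {1}/product_measure1 => ->.
apply: integral_le_cst_supp => //= y yJ.
rewrite (_ : ysection A y = set0) ?measure0//.
by apply/seteqP; split => // x; rewrite /ysection/= => /set_mem /AJ.
Qed.

(** * Area of thin annuli *)

Section planar.
Variable R : realType.
Local Notation mR := (measurableTypeR R).
Local Notation lam := (@lebesgue_measure R).
Local Notation lam2 := (lam \x lam)%E.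

Lemma lebesgue_le_diam (S : set mR) (e : R) : measurable S -> 0 <= e ->
  (forall x y, S x -> S y -> x - y <= e) -> (lam S <= (2 * e)%:E)%E.
Proof.
move=> mS e0 Se; have [->|/set0P[x0 Sx0]] := eqVneq S set0.
  by rewrite measure0 lee_fin mulr_ge0.
have SI : S `<=` [set` `[x0 - e, x0 + e]].
  move=> x Sx; rewrite /= in_itv/=.
  by have := Se _ _ Sx Sx0; have := Se _ _ Sx0 Sx; lra.
apply: (le_trans (le_measure lam _ _ SI)); rewrite ?inE//=.
by rewrite lebesgue_measure_itv/=; case: ifPn => _; rewrite -?EFinB lee_fin; lra.
Qed.

Definition sqr_shell (r e : R) : set mR :=
  [set y | [/\ 2^-1 <= `|y|, r - e < y ^+ 2 & y ^+ 2 < r]].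

Lemma measurable_norm_ge (c : R) : measurable [set x : mR | c <= `|x|].
Proof.
rewrite [X in measurable X](_ : _ = ~` [set x : mR | `|x| < c]).
  by apply: measurableC; exact: measurable_ltr.
by apply/seteqP; split => y /=; rewrite leNgt => /negP.
Qed.

Lemma measurable_sqr_shell r e : measurable (sqr_shell r e).
Proof.
rewrite (_ : sqr_shell r e = [set y : mR | 2^-1 <= `|y|] `&`
  ([set y | r - e < y ^+ 2] `&` [set y | y ^+ 2 < r])).
  apply: measurableI; first exact: measurable_norm_ge.
  by apply: measurableI; exact: measurable_ltr.
by apply/seteqP; split => y /= [] // ? [].
Qed.

(** Away from 0 the square function expands distances, so on each half-line the
    preimage of an interval of length [e] has diameter at most [e]. *)
Lemma lebesgue_sqr_shell_le (r e : R) : 0 <= e ->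
  (lam (sqr_shell r e) <= (4 * e)%:E)%E.
Proof.
move=> e0; pose S (s : R) := sqr_shell r e `&` [set y : mR | 0 <= s * y].
have mS s : measurable (S s).
  apply: measurableI; first exact: measurable_sqr_shell.
  rewrite [X in measurable X](_ : _ = ~` [set y : mR | s * y < 0]).
    by apply: measurableC; exact: measurable_ltr.
  by apply/seteqP; split => y /=; rewrite leNgt => /negP.
have Sle s : s ^+ 2 = 1 -> (lam (S s) <= (2 * e)%:E)%E.
  move=> s1; apply: lebesgue_le_diam => // x y [[xh x1 x2] /= sx] [[yh y1 y2] /= sy].
  have /orP[/eqP s1'|/eqP s1'] : (s == 1) || (s == -1) by
    rewrite -eqf_sqr s1 expr1n.
  - rewrite s1' !mul1r in sx sy.
    rewrite ger0_norm// in xh; rewrite ger0_norm// in yh; nra.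
  - rewrite s1' !mulN1r !oppr_ge0 in sx sy.
    rewrite ler0_norm// in xh; rewrite ler0_norm// in yh; nra.
have SI : sqr_shell r e `<=` S 1 `|` S (-1).
  by move=> y yS; case: (ler0P y) => y0; [right|left]; split => //=; lra.
apply: (le_trans (le_measure lam _ _ SI)); rewrite ?inE//=.
- exact: measurable_sqr_shell.
- exact: measurableU.
apply: (le_trans (measureU2 _ _ _)) => //.
apply: (le_trans (leeD (Sle _ _) (Sle _ _))); rewrite ?sqrrN ?expr1n//.
by rewrite -EFinD lee_fin; lra.
Qed.

Definition shell (e a b t : R) : set (mR * mR) :=
  [set z | [/\ 1 - e < z.1 ^+ 2 + z.2 ^+ 2, z.1 ^+ 2 + z.2 ^+ 2 < 1,
    `|z.1 - a| < t & `|z.2 - b| < t]].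

Definition line_ball (a t : R) : set mR := [set x | `|x - a| < t].

Lemma measurable_line_ball (a t : R) : measurable (line_ball a t).
Proof.
apply: measurable_ltr => //.
apply: (measurableT_comp (@normr_measurable _ _)).
exact: measurable_funB.
Qed.

Lemma lebesgue_line_ball (a t : R) : 0 <= t ->
  lam (line_ball a t) = (2 * t)%:E.
Proof.
move=> t0; have -> : line_ball a t = [set` `]a - t, a + t[].
  apply/seteqP; rewrite /line_ball; split => x /=;
    rewrite in_itv/= ltr_norml => /andP[? ?]; apply/andP; split; lra.
rewrite lebesgue_measure_itv/= lte_fin -EFinB; case: ltP => ?; congr (_%:E); lra.
Qed.

Lemma measurable_shell (e a b t : R) : measurable (shell e a b t).
Proof.
have m2 : measurable_fun setT (fun z : mR * mR => z.1 ^+ 2 + z.2 ^+ 2).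
  by apply: measurable_funD; apply: measurable_funX;
    [exact: measurable_fst|exact: measurable_snd].
have -> : shell e a b t = [set z | 1 - e < z.1 ^+ 2 + z.2 ^+ 2] `&`
    [set z | z.1 ^+ 2 + z.2 ^+ 2 < 1] `&`
    (line_ball a t `*` line_ball b t).
  by apply/seteqP; split => z /=; [case|case => -[? ?] []].
apply: measurableI; first by apply: measurableI; exact: measurable_ltr.
by apply: measurableX; exact: measurable_line_ball.
Qed.

(** Every point of the annulus has a coordinate of modulus at least 1/2.  Where
    it is the second one, the vertical sections are short, and the square
    confines the first coordinate to an interval of length [2 t]; where it is
    the first one, the roles are exchanged. *)
Lemma area_shell_le (e a b t : R) : 0 <= e -> e <= 2^-1 -> 0 <= t ->
  (lam2 (shell e a b t) <= (16 * e * t)%:E)%E.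
Proof.
move=> e0 e2 t0.
have mhalf := measurable_norm_ge 2^-1.
pose X := shell e a b t `&` [set x : mR | 2^-1 <= `|x|] `*` setT.
pose Y := shell e a b t `&` (setT `*` [set y : mR | 2^-1 <= `|y|]).
have mX : measurable X.
  by apply: measurableI; [exact: measurable_shell|exact: measurableX].
have mY : measurable Y.
  by apply: measurableI; [exact: measurable_shell|exact: measurableX].
have mU : measurable (Y `|` X) by exact: measurableU.
have SI : shell e a b t `<=` Y `|` X.
  move=> [x y] S; have [/= z1 z2 z3 z4] := S.
  have [xh|xh] := leP 2^-1 `|x|; first by right.
  have [yh|yh] := leP 2^-1 `|y|; first by left.
  have : x ^+ 2 + y ^+ 2 < 2^-1.
    rewrite -(real_normK (num_real x)) -(real_normK (num_real y)).
    have := normr_ge0 x; have := normr_ge0 y; nra.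
  lra.
have lY : (lam2 Y <= (8 * e * t)%:E)%E.
  have H : (lam2 Y <= (4 * e)%:E * lam (line_ball a t))%E.
    apply: product_measure_le_xsection => //; first exact: measurable_line_ball.
    - by rewrite mulr_ge0.
    - by move=> x y [[]].
    move=> x _; apply: le_trans (lebesgue_sqr_shell_le (1 - x ^+ 2) e0).
    apply: le_measure; rewrite ?inE.
    - exact: measurable_xsection.
    - exact: measurable_sqr_shell.
    move=> y; rewrite /xsection/= => /set_mem[[/= h1 h2 _ _] [_ /= h]].
    by split => //; lra.
  by apply: (le_trans H); rewrite lebesgue_line_ball// -EFinM lee_fin; lra.
have lX : (lam2 X <= (8 * e * t)%:E)%E.
  have H : (lam2 X <= (4 * e)%:E * lam (line_ball b t))%E.
    apply: product_measure_le_ysection => //; first exact: measurable_line_ball.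
    - by rewrite mulr_ge0.
    - by move=> x y [[]].
    move=> x _; apply: le_trans (lebesgue_sqr_shell_le (1 - x ^+ 2) e0).
    apply: le_measure; rewrite ?inE.
    - exact: measurable_ysection.
    - exact: measurable_sqr_shell.
    move=> y; rewrite /ysection/= => /set_mem[[/= h1 h2 _ _] [/= h _]].
    by split => //; lra.
  by apply: (le_trans H); rewrite lebesgue_line_ball// -EFinM lee_fin; lra.
apply: (le_trans (le_measure _ _ _ SI)); rewrite ?inE//=.
  exact: measurable_shell.
apply: (le_trans (measureU2 _ _ _)) => //.
by apply: (le_trans (leeD lY lX)); rewrite -EFinD lee_fin; lra.
Qed.

End planar.

(** * Volume of neighborhoods of the diagonal and norm of midpoint powers *)

Section volume.
Variable R : realType.
Local Notation mR := (measurableTypeR R).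
Local Notation lam := (@lebesgue_measure R).
Local Notation lam2 := (lam \x lam)%E.
Local Notation C := R[i]^o.

Lemma normc_sqr (x y : R) : normc (x +i* y)%C ^+ 2 = x ^+ 2 + y ^+ 2.
Proof. by rewrite /= sqr_sqrtr// addr_ge0// sqr_ge0. Qed.

Lemma normc_ge0 (z : R[i]) : 0 <= normc z.
Proof. by case: z => x y; exact: sqrtr_ge0. Qed.

Lemma normcX (z : R[i]) n : normc (z ^+ n) = normc z ^+ n.
Proof.
by elim: n => [|n IH]; rewrite ?expr0 ?normc1// !exprS normcM IH.
Qed.

Lemma normc_lt1 (x y : R) : (normc (x +i* y)%C < 1) = (x ^+ 2 + y ^+ 2 < 1).
Proof.
by rewrite -normc_sqr expr_lt1// normc_ge0.
Qed.

Lemma dA_le (S : set (mR * mR)) : (dA S <= lam2 S)%E.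
Proof.
rewrite /dA/= /mscale/= -[leRHS]mul1e lee_wpmul2r// lee_fin.
by rewrite invf_le1 ?pi_gt0//; have := @pi_ge2 R; lra.
Qed.

Definition near_diagonal (e t : R) : set ((mR * mR) * (mR * mR)) :=
  [set w | [/\ shell e 0 0 1 w.1, shell e 0 0 1 w.2,
    `|w.2.1 - w.1.1| < t & `|w.2.2 - w.1.2| < t]].

Lemma measurable_near_diagonal e t : measurable (near_diagonal e t).
Proof.
pose c (i j : (mR * mR) * (mR * mR) -> mR) := [set w | `|i w - j w| < t].
have mc i j : measurable_fun setT i -> measurable_fun setT j -> measurable (c i j).
  move=> mi mj; apply: measurable_ltr => //.
  apply: (measurableT_comp (@normr_measurable _ _)).
  exact: measurable_funB.
rewrite (_ : near_diagonal e t = (shell e 0 0 1 `*` shell e 0 0 1) `&`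
  (c (fun w => w.2.1) (fun w => w.1.1) `&` c (fun w => w.2.2) (fun w => w.1.2))).
  apply: measurableI; first by apply: measurableX; exact: measurable_shell.
  apply: measurableI; apply: mc.
  - exact: (measurableT_comp measurable_fst measurable_snd).
  - exact: (measurableT_comp measurable_fst measurable_fst).
  - exact: (measurableT_comp measurable_snd measurable_snd).
  - exact: (measurableT_comp measurable_snd measurable_fst).
by apply/seteqP; split => w /=; [case|case => -[? ?] []].
Qed.

(** For a fixed first point, the second one ranges over the part of the annulus
    in a square of side [2 t] centered at the first. *)
Lemma volume_near_diagonal_le e t : 0 <= e -> e <= 2^-1 -> 0 <= t ->
  ((dA (R:=R) \x dA (R:=R)) (near_diagonal e t) <= (256 * e ^+ 2 * t)%:E)%E.
Proof.
move=> e0 e2 t0.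
have H : ((dA (R:=R) \x dA (R:=R)) (near_diagonal e t) <=
    (16 * e * t)%:E * dA (R:=R) (shell e 0 0 1))%E.
  apply: product_measure_le_xsection.
  - exact: measurable_shell.
  - by rewrite !mulr_ge0.
  - by move=> x y [].
  move=> x _; apply: le_trans (dA_le _) _.
  apply: le_trans (area_shell_le x.1 x.2 e0 e2 t0).
  apply: le_measure; rewrite ?inE.
  - apply: measurable_xsection; exact: measurable_near_diagonal.
  - exact: measurable_shell.
  by move=> y; rewrite /xsection/= => /set_mem[_ /= [? ? _ _] ? ?].
apply: le_trans H _.
have := le_trans (dA_le _) (area_shell_le 0 0 e0 e2 (@ler01 R)).
move=> /(lee_wpmul2l _) => /(_ (16 * e * t)%:E).
rewrite lee_fin !mulr_ge0// => /(_ isT) /le_trans; apply.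
by rewrite -EFinM lee_fin; nra.
Qed.

Definition midpoint_power (N : nat) (w : C * C) : C := ((w.1 + w.2) / 2) ^+ N.

Definition box4 : set ((mR * mR) * (mR * mR)) :=
  (line_ball 0 1 `*` line_ball 0 1) `*` (line_ball 0 1 `*` line_ball 0 1).

Lemma measurable_box4 : measurable box4.
Proof.
by apply: measurableX; apply: measurableX; exact: measurable_line_ball.
Qed.

Lemma volume_box4 : ((dA (R:=R) \x dA (R:=R)) box4 <= 16%:E)%E.
Proof.
have mb := @measurable_line_ball R 0 1.
have lb : (dA (R:=R) (line_ball 0 1 `*` line_ball 0 1) <= 4%:E)%E.
  apply: le_trans (dA_le _) _.
  by rewrite product_measure1E//= lebesgue_line_ball// -EFinM lee_fin; lra.
rewrite product_measure1E; [|exact: measurableX..].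
apply: (@le_trans _ _ (4%:E * 4%:E)%E); last by rewrite -EFinM lee_fin; lra.
by apply: lee_pmul.
Qed.

Lemma bidisc_box4 w : bidisc (of_coords w) -> box4 w.
Proof.
case: w => -[x1 y1] [x2 y2] [/=].
rewrite -![Num.sqrt _]/(normc (_ +i* _)%C) !normc_lt1 => h1 h2.
by split; split; rewrite /line_ball/= subr0 ltr_norml; nra.
Qed.

(** The parallelogram identity: the modulus of a midpoint in the disc is close
    to 1 only if both ends are close to the circle and to each other. *)
Lemma normc_midpoint (x1 y1 x2 y2 : R) :
  normc (((x1 +i* y1) + (x2 +i* y2)) / 2)%C ^+ 2 =
  ((x1 ^+ 2 + y1 ^+ 2) + (x2 ^+ 2 + y2 ^+ 2)) / 2
  - ((x2 - x1) ^+ 2 + (y2 - y1) ^+ 2) / 4.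
Proof.
have -> : normc (((x1 +i* y1) + (x2 +i* y2)) / 2)%C ^+ 2 =
    normc ((x1 + x2) +i* (y1 + y2))%C ^+ 2 / 4.
  rewrite normcM exprMn normcV; congr (_ * _).
  have -> : (2 : R[i]) = (2 +i* 0)%C by apply/eqP; rewrite eq_complex /= addr0 !eqxx.
  by rewrite exprVn normc_sqr; congr (_^-1); ring.
by rewrite normc_sqr; field.
Qed.

Lemma normc_midpoint_power N w : normc (midpoint_power N w) ^+ 2 =
  (normc ((w.1 + w.2) / 2) ^+ 2) ^+ N.
Proof. by rewrite /midpoint_power normcX -!exprM mulnC. Qed.

Lemma midpoint_power_le1 (N : nat) w : bidisc (of_coords w) ->
  normc (midpoint_power N (of_coords w)) ^+ 2 <= 1.
Proof.
case: w => -[x1 y1] [x2 y2] [/=].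
rewrite -![Num.sqrt _]/(normc (_ +i* _)%C) !normc_lt1 => h1 h2.
rewrite normc_midpoint_power exprn_ile1 ?sqr_ge0// normc_midpoint/=.
by have := sqr_ge0 (x2 - x1); have := sqr_ge0 (y2 - y1); lra.
Qed.

Lemma midpoint_power_le (N : nat) (s : R) w :
  0 < s -> s <= 1 -> bidisc (of_coords w) ->
  ~ near_diagonal (2 * s ^+ 2) (2 * s) w ->
  normc (midpoint_power N (of_coords w)) ^+ 2 <= (1 - s ^+ 2) ^+ N.
Proof.
case: w => -[x1 y1] [x2 y2] s0 s1 [/=].
rewrite -![Num.sqrt _]/(normc (_ +i* _)%C) !normc_lt1 => h1 h2 nd.
rewrite normc_midpoint_power; apply: lerXn2r; rewrite ?nnegrE ?sqr_ge0//.
  nra.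
rewrite normc_midpoint/= leNgt; apply/negP => far; apply: nd.
have := sqr_ge0 (x2 - x1); have := sqr_ge0 (y2 - y1) => d1 d2.
by split; rewrite /shell/= ?ltr_norml; [split; rewrite ?subr0 ?ltr_norml; nra..| |];
  apply/andP; split; nra.
Qed.

Lemma A2_sqnorm_midpoint_power_le (N : nat) (s : R) : 0 < s -> s <= 2^-1 ->
  (A2_sqnorm (midpoint_power N) <= (2048 * s ^+ 5 + 16 * (1 - s ^+ 2) ^+ N)%:E)%E.
Proof.
move=> s0 s2.
have s21 : 0 <= 1 - s ^+ 2 by nra.
have k0 : 0 <= (1 - s ^+ 2) ^+ N by exact: exprn_ge0.
pose E := near_diagonal (2 * s ^+ 2) (2 * s).
have mE : measurable E by exact: measurable_near_diagonal.
pose g w : \bar R := ((\1_E w)%:E + ((1 - s ^+ 2) ^+ N)%:E * (\1_box4 w)%:E)%E.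
have H : (A2_sqnorm (midpoint_power N) <= \int[dA (R:=R) \x dA (R:=R)]_w g w)%E.
  rewrite /A2_sqnorm integral_mkcond; apply: ge0_le_integralT.
    by move=> w; rewrite patchE; case: ifPn => // _; rewrite lee_fin sqr_ge0.
  move=> w; rewrite patchE; case: ifPn => [/set_mem Dw|_]; last first.
    by rewrite adde_ge0// ?mule_ge0// lee_fin.
  rewrite /g [\1_box4 _]indicE mem_set ?mule1; last exact: bidisc_box4.
  rewrite [\1_E _]indicE; have [Ew|/negP Ew] := boolP (w \in E); last first.
    rewrite add0e lee_fin; apply: midpoint_power_le => //; first lra.
    by move=> /mem_set.
  by rewrite -EFinD lee_fin (le_trans (midpoint_power_le1 N Dw))// lerDl.
apply: le_trans H _; rewrite /g.
have msq := measurable_box4.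
rewrite ge0_integralD//=; first last.
- by apply/measurable_EFinP; exact: measurable_funM.
- by move=> *; rewrite lee_fin mulr_ge0.
- exact/measurable_EFinP.
rewrite ge0_integralZl_EFin//; last exact/measurable_EFinP.
rewrite !integral_indic// !setIT EFinD; apply: leeD.
  apply: le_trans (volume_near_diagonal_le _ _ _) _; rewrite ?lee_fin//; try nra.
rewrite (mulrC 16) EFinM; apply: lee_wpmul2l; first by rewrite lee_fin.
exact: volume_box4.
Qed.
End volume.

(** * Polynomials and their reflections near the torus *)

Section lipschitz.
Variable R : realType.
Local Notation C := R[i]^o.
Local Notation C2 := (C * C)%type.

Lemma normc_sub_sym (z w : R[i]) : normc (z - w) = normc (w - z).
Proof. by rewrite -(normcN (z - w)) opprB. Qed.

Lemma normc_sub_le (z w : R[i]) : normc z - normc w <= normc (z - w).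
Proof. by rewrite lerBlDr -{1}(subrK w z); exact: le_normcD. Qed.

Definition closed_bidisc : set C2 := [set z | normc z.1 <= 1 /\ normc z.2 <= 1].

Definition dist1 (z w : C2) : R := normc (z.1 - w.1) + normc (z.2 - w.2).

Lemma dist1_ge0 z w : 0 <= dist1 z w.
Proof. by rewrite addr_ge0 ?normc_ge0. Qed.

(** Boundedness is included so that the class is stable under products. *)
Definition bounded_lipschitz (F : C2 -> C) : Prop :=
  exists2 K : R, 0 <= K & forall z w, closed_bidisc z -> closed_bidisc w ->
    normc (F z) <= K /\ normc (F z - F w) <= K * dist1 z w.

Lemma bounded_lipschitz_cst c : bounded_lipschitz (fun=> c).
Proof.
exists (normc c) => [|z w _ _]; first exact: normc_ge0.
by rewrite subrr normc0 mulr_ge0 ?normc_ge0 ?dist1_ge0.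
Qed.

Lemma bounded_lipschitz_fst : bounded_lipschitz fst.
Proof.
by exists 1 => // z w [z1 _] _; rewrite mul1r lerDl normc_ge0.
Qed.

Lemma bounded_lipschitz_snd : bounded_lipschitz snd.
Proof.
by exists 1 => // z w [_ z2] _; rewrite mul1r lerDr normc_ge0.
Qed.

Lemma bounded_lipschitzD F G : bounded_lipschitz F -> bounded_lipschitz G ->
  bounded_lipschitz (fun z => F z + G z).
Proof.
move=> [K K0 FK] [L L0 GL]; exists (K + L) => [|z w zb wb]; first exact: addr_ge0.
have [F1 F2] := FK z w zb wb; have [G1 G2] := GL z w zb wb.
split; first by apply: le_trans (le_normcD _ _) _; exact: lerD.
rewrite opprD addrACA mulrDl; apply: le_trans (le_normcD _ _) _; exact: lerD.
Qed.

Lemma bounded_lipschitzM F G : bounded_lipschitz F -> bounded_lipschitz G ->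
  bounded_lipschitz (fun z => F z * G z).
Proof.
move=> [K K0 FK] [L L0 GL]; exists (2 * K * L + K * L).
  by rewrite addr_ge0 ?mulr_ge0.
move=> z w zb wb.
have [F1 F2] := FK z w zb wb; have [G1 G2] := GL z w zb wb.
have [G3 _] := GL w w wb wb.
have d0 := dist1_ge0 z w.
split.
  rewrite normcM; apply: (@le_trans _ _ (K * L)); last by rewrite lerDr !mulr_ge0.
  by apply: ler_pM; rewrite ?normc_ge0.
have -> : F z * G z - F w * G w = F z * (G z - G w) + (F z - F w) * G w by ring.
apply: le_trans (le_normcD _ _) _; rewrite !normcM.
apply: (@le_trans _ _ (K * (L * dist1 z w) + K * dist1 z w * L)).
  by apply: lerD; apply: ler_pM; rewrite ?normc_ge0.
have : 0 <= K * L * dist1 z w by rewrite !mulr_ge0.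
lra.
Qed.

Lemma bounded_lipschitz_peval p : bounded_lipschitz (peval p).
Proof.
rewrite /peval; elim/poly_ind: p => [|p c IHp].
  under eq_fun do rewrite !horner0; exact: bounded_lipschitz_cst.
under eq_fun do rewrite hornerMXaddC hornerD hornerM hornerC.
apply: bounded_lipschitzD.
  by apply: bounded_lipschitzM => //; exact: bounded_lipschitz_fst.
elim/poly_ind: c => [|c a IHc].
  under eq_fun do rewrite horner0; exact: bounded_lipschitz_cst.
under eq_fun do rewrite hornerMXaddC.
apply: bounded_lipschitzD; last exact: bounded_lipschitz_cst.
by apply: bounded_lipschitzM => //; exact: bounded_lipschitz_snd.
Qed.

Lemma conjc_unimodular (z : R[i]) : normc z = 1 -> (conjc z)^-1 = z.
Proof.
case: z => x y z1.
have xy : x ^+ 2 + y ^+ 2 = 1 by rewrite -normc_sqr z1 expr1n.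
have zz : conjc (x +i* y)%C * (x +i* y)%C = 1.
  apply/eqP; rewrite eq_complex /=; apply/andP; split; apply/eqP; [rewrite -xy|]; ring.
have c0 : conjc (x +i* y)%C != 0.
  by apply/eqP => c0; move: zz; rewrite c0 mul0r => /esym/eqP; rewrite oner_eq0.
by apply: (mulfI c0); rewrite divff// zz.
Qed.

Lemma normc_conjc (z : R[i]) : normc (conjc z) = normc z.
Proof. by case: z => x y /=; rewrite sqrrN. Qed.

(** On the torus, [1 / conj z = z]. *)
Lemma normc_reflection_torus p (z : C2) : torus z ->
  normc (peval (reflection p) z) = normc (peval p z).
Proof.
case: z => z1 z2 [/= h1 h2].
have n0 (z : R[i]) : normc z = 1 -> z != 0.
  by move=> h; apply/eqP => z0; move: h; rewrite z0 normc0 => /esym/eqP; rewrite oner_eq0.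
rewrite reflectionE /= ?n0// !normcM !normcX h1 h2 !expr1n !mul1r.
by rewrite normc_conjc !conjc_unimodular.
Qed.

(** The numerator and the denominator have the same modulus at [zeta], and each
    changes by at most a constant times the distance from [zeta] to [z]. *)
Lemma normc_quotient_ge p : exists2 K : R, 0 <= K &
  forall (z zeta : C2) m, closed_bidisc z -> torus zeta -> 0 < m ->
    m <= normc (peval p z) ->
    1 - K * dist1 z zeta / m <= normc (peval (reflection p) z / peval p z).
Proof.
have [K K0 pK] := bounded_lipschitz_peval p.
have [L L0 rL] := bounded_lipschitz_peval (reflection p).
exists (K + L) => [|z zeta m zb zt m0 mp]; first exact: addr_ge0.
have zetab : closed_bidisc zeta by case: zt => a b; split; rewrite (a, b).
have [_ h1] := pK _ _ zb zetab; have [_ h2] := rL _ _ zetab zb.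
have h3 := normc_sub_le (peval p z) (peval p zeta).
have h4 := normc_sub_le (peval (reflection p) zeta) (peval (reflection p) z).
rewrite normc_reflection_torus// in h4.
have ds : dist1 zeta z = dist1 z zeta.
  by rewrite /dist1 normc_sub_sym (normc_sub_sym zeta.2).
rewrite ds in h2.
have pz0 : 0 < normc (peval p z) := lt_le_trans m0 mp.
rewrite normcM normcV ler_pdivlMr// mulrBl mul1r.
have : (K + L) * dist1 z zeta <= (K + L) * dist1 z zeta / m * normc (peval p z).
  rewrite -mulrA ler_peMr ?mulr_ge0 ?addr_ge0 ?normc_ge0//.
  by rewrite mulrC ler_pdivlMr// mul1r.
lra.
Qed.
End lipschitz.

(** * Strips along the unit circle *)

Section strip.
Variable R : realType.
Local Notation mR := (measurableTypeR R).
Local Notation lam := (@lebesgue_measure R).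
Local Notation lam2 := (lam \x lam)%E.
Local Notation C := R[i]^o.

Definition upper_point (x : R) : R[i] := (x +i* Num.sqrt (1 - x ^+ 2))%C.

(** A one-sided neighborhood of an arc of the upper unit half-circle, cut
    vertically rather than radially so that its sections are intervals of length
    [d]. *)
Definition strip (b h d : R) : set (mR * mR) :=
  [set z | [/\ `|z.1 - b| < h, Num.sqrt (1 - z.1 ^+ 2) - d < z.2
    & z.2 < Num.sqrt (1 - z.1 ^+ 2)]].

Lemma measurable_strip b h d : measurable (strip b h d).
Proof.
have ms : measurable_fun setT (fun z : mR * mR => Num.sqrt (1 - z.1 ^+ 2)).
  apply: (@measurableT_comp _ _ _ _ _ _ (@Num.sqrt R)).
    by apply: continuous_measurable_fun; exact: sqrt_continuous.
  apply: measurable_funB => //; apply: measurable_funX; exact: measurable_fst.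
have m2 : measurable_fun setT (fun z : mR * mR => z.2) by exact: measurable_snd.
rewrite (_ : strip b h d = (line_ball b h `*` setT) `&`
  ([set z | Num.sqrt (1 - z.1 ^+ 2) - d < z.2] `&`
   [set z | z.2 < Num.sqrt (1 - z.1 ^+ 2)])).
  apply: measurableI.
    by apply: measurableX => //; exact: measurable_line_ball.
  by apply: measurableI; apply: measurable_ltr => //; exact: measurable_funB.
by apply/seteqP; split => z /=; [case|case => -[? _] []].
Qed.

Lemma dA_strip_ge b h d : 0 <= h -> 0 <= d ->
  ((2 * h * d / pi)%:E <= dA (R:=R) (strip b h d))%E.
Proof.
move=> h0 d0.
have H : (d%:E * lam (line_ball b h) <= lam2 (strip b h d))%E.
  apply: product_measure_ge_xsection => //; first exact: measurable_line_ball.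
  move=> x xb.
  have -> : xsection (strip b h d) x =
      [set` `]Num.sqrt (1 - x ^+ 2) - d, Num.sqrt (1 - x ^+ 2)[].
    apply/seteqP; rewrite /xsection; split => y /=; rewrite in_itv/=.
      by move=> /set_mem[_ /= -> ->].
    by move=> /andP[y1 y2]; apply/mem_set.
  rewrite -[leRHS]/(lam _) lebesgue_measure_itv/= lte_fin -EFinB.
  by case: ltP => ?; rewrite lee_fin; lra.
rewrite lebesgue_line_ball// -EFinM in H.
rewrite /dA/= /mscale/= mulrC EFinM lee_wpmul2l//.
  by rewrite lee_fin invr_ge0 pi_ge0.
by apply: le_trans H; rewrite lee_fin; lra.
Qed.

Lemma sqrt_onem_sqr_ge (x : R) : `|x| <= 3 / 4 -> 2^-1 <= Num.sqrt (1 - x ^+ 2).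
Proof.
move=> x34; have x2 : x ^+ 2 <= 9 / 16.
  rewrite -(real_normK (num_real x)); have := normr_ge0 x; nra.
rewrite -(@ler_pXn2r _ 2) ?nnegrE ?sqrtr_ge0 ?invr_ge0// sqr_sqrtr; lra.
Qed.

Lemma normc_upper_point (x : R) : `|x| <= 3 / 4 -> normc (upper_point x) = 1.
Proof.
move=> x34; have x2 : x ^+ 2 <= 9 / 16.
  rewrite -(real_normK (num_real x)); have := normr_ge0 x; nra.
by rewrite /upper_point/= sqr_sqrtr; last lra; rewrite addrC subrK sqrtr1.
Qed.

Lemma normc_le_abs (x y : R) : normc (x +i* y)%C <= `|x| + `|y|.
Proof.
rewrite -(@ler_pXn2r _ 2) ?nnegrE ?normc_ge0 ?addr_ge0//.
rewrite normc_sqr -(real_normK (num_real x)) -(real_normK (num_real y)).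
by have := mulr_ge0 (normr_ge0 x) (normr_ge0 y); nra.
Qed.

Lemma upper_point_lipschitz (x b : R) : `|x| <= 3 / 4 -> `|b| <= 3 / 4 ->
  normc (upper_point x - upper_point b) <= 3 * `|x - b|.
Proof.
move=> xh bh.
apply: le_trans (normc_le_abs _ _) _.
have sx := sqrt_onem_sqr_ge xh; have sb := sqrt_onem_sqr_ge bh.
have Ex : Num.sqrt (1 - x ^+ 2) ^+ 2 = 1 - x ^+ 2.
  rewrite sqr_sqrtr// -(real_normK (num_real x)); have := normr_ge0 x; nra.
have Eb : Num.sqrt (1 - b ^+ 2) ^+ 2 = 1 - b ^+ 2.
  rewrite sqr_sqrtr// -(real_normK (num_real b)); have := normr_ge0 b; nra.
set u := Num.sqrt _ in sx Ex *; set v := Num.sqrt _ in sb Eb *.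
have : `|u - v| * (u + v) = `|x - b| * `|x + b|.
  rewrite -normrM -[u + v]ger0_norm; last lra.
  by rewrite -normrM -normrN; congr (`|_|); lra.
have xb : `|x + b| <= 3 / 2 by apply: le_trans (ler_normD _ _) _; lra.
have := normr_ge0 (x - b); have := normr_ge0 (u - v) => u0 x0 E.
have : `|u - v| <= `|u - v| * (u + v) by rewrite ler_peMr//; lra.
have : `|x - b| * `|x + b| <= `|x - b| * (3 / 2) by rewrite ler_wpM2l.
lra.
Qed.

Lemma stripP (b h d : R) (z : mR * mR) : `|b| <= 2^-1 -> h <= 4^-1 -> d <= h ->
  0 < h -> strip b h d z ->
  [/\ normc (z.1 +i* z.2)%C < 1, normc (upper_point z.1) = 1,
     normc ((z.1 +i* z.2)%C - upper_point z.1) <= d &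
     normc ((z.1 +i* z.2)%C - upper_point b) <= 4 * h].
Proof.
case: z => x y /= bh h4 dh h0 [/= xb y1 y2].
have xh : `|x| <= 3 / 4.
  by rewrite -(subrK b x); apply: le_trans (ler_normD _ _) _; lra.
have bh' : `|b| <= 3 / 4 by lra.
have sx := sqrt_onem_sqr_ge xh.
have d3 : normc ((x +i* y)%C - upper_point x) <= d.
  apply: le_trans (normc_le_abs _ _) _.
  rewrite subrr normr0 add0r ler_norml; apply/andP; split; lra.
have d4 : normc ((x +i* y)%C - upper_point b) <= 4 * h.
  rewrite -(subrKA (upper_point x)); apply: le_trans (le_normcD _ _) _.
  by have := upper_point_lipschitz xh bh'; lra.
split => //.
- rewrite -[Num.sqrt _]/(normc (_ +i* _)%C) normc_lt1.
  have Ex : Num.sqrt (1 - x ^+ 2) ^+ 2 = 1 - x ^+ 2.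
    rewrite sqr_sqrtr// -(real_normK (num_real x)); have := normr_ge0 x; nra.
  nra.
exact: normc_upper_point.
Qed.
End strip.

(** * Norm of the powers of the inner function *)

Lemma bernoulli_le (R : realDomainType) (x : R) n : -1 <= x ->
  1 + n%:R * x <= (1 + x) ^+ n.
Proof.
move=> x1; elim: n => [|n IH]; first by rewrite mul0r addr0 expr0.
have x0 : 0 <= 1 + x by lra.
rewrite exprS; apply: le_trans (ler_wpM2l x0 IH).
have : 0 <= n%:R * x ^+ 2 by rewrite mulr_ge0 ?sqr_ge0.
rewrite -natr1; lra.
Qed.

Section main.
Variable R : realType.
Local Notation mR := (measurableTypeR R).
Local Notation C := R[i]^o.
Local Notation C2 := (C * C)%type.

Lemma differentiable_midpoint_power N (z : C2) : differentiable (@midpoint_power R N) z.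
Proof.
have dfst : differentiable (fst : C2 -> C) z.
  by apply: linear_differentiable => w; exact: cvg_fst.
have dsnd : differentiable (snd : C2 -> C) z.
  by apply: linear_differentiable => w; exact: cvg_snd.
have dmid : differentiable (2^-1 *: (fst + snd : C2 -> C)) z.
  by apply: differentiableZ; exact: differentiableD.
elim: N => [|N IH].
  have -> : @midpoint_power R 0 = cst 1.
    by apply/funext => w; rewrite /midpoint_power expr0.
  exact: differentiable_cst.
have -> : @midpoint_power R N.+1 =
    (2^-1 *: (fst + snd : C2 -> C)) * @midpoint_power R N.
  by apply/funext => w; rewrite /midpoint_power exprS; congr (_ * _); exact: mulrC.
exact: differentiableM.
Qed.

(** The zero of [p] on the torus is unique, so of two points one avoids it. *)
Lemma torus_point_nonzero (p : {poly {poly R[i]}}) tau :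
  pzeros p `&` torus (R := R) = [set tau] ->
  exists2 b : R, `|b| <= 2^-1 & peval p (upper_point b, upper_point 0) != 0.
Proof.
move=> pt.
have ptau b : `|b| <= 3 / 4 -> peval p (upper_point b, upper_point 0) = 0 ->
    (upper_point b, upper_point 0) = tau.
  move=> bh pb; have : (pzeros p `&` torus (R := R)) (upper_point b, upper_point 0).
    by split => //; split; apply: normc_upper_point => //; rewrite normr0; lra.
  by rewrite pt.
have h0 : `|0 : R| <= 2^-1 by rewrite normr0; lra.
have h2 : `|2^-1 : R| <= 2^-1 by rewrite ger0_norm; lra.
have [p0|p0] := eqVneq (peval p (upper_point 0, upper_point 0)) 0; last by exists 0.
have [p2|p2] := eqVneq (peval p (upper_point 2^-1, upper_point 0)) 0;
  last by exists 2^-1.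
have w0 : `|0 : R| <= 3 / 4 by lra.
have w2 : `|2^-1 : R| <= 3 / 4 by lra.
have := congr1 (fun z : C2 => complex.Re z.1)
  (etrans (ptau _ w0 p0) (esym (ptau _ w2 p2))).
by rewrite /upper_point/= => h; move: {pt} h; lra.
Qed.

Lemma quotient_near_arcs (p : {poly {poly R[i]}}) (b : R) :
  `|b| <= 2^-1 -> peval p (upper_point b, upper_point 0) != 0 ->
  exists h L : R, [/\ 0 < h, h <= 4^-1, 0 <= L &
    forall d z1 z2, d <= h -> strip b h d z1 -> strip 0 h d z2 ->
      bidisc (of_coords (z1, z2)) /\
      1 - L * d <= normc (peval (reflection p) (of_coords (z1, z2)) /
                          peval p (of_coords (z1, z2)))].
Proof.
move=> bh pb.
have [K K0 pK] := bounded_lipschitz_peval p.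
have [L L0 rL] := normc_quotient_ge p.
set A := normc (peval p (upper_point b, upper_point 0)).
have A0 : 0 < A.
  by rewrite lt0r normc_ge0 andbT; apply: contra pb => /eqP/eq0_normc ->.
(* The points of the two strips are within 8 h of the base point in the
   distance dist1, so that p varies there by at most A / 2. *)
pose h := Num.min 4^-1 (A / (16 * (K + 1))).
have hA : h <= A / (16 * (K + 1)) by rewrite ge_min lexx orbT.
have h0 : 0 < h by rewrite lt_min invr_gt0 ltr0n divr_gt0// mulr_gt0//; lra.
have h4 : h <= 4^-1 by rewrite ge_min lexx.
exists h, (4 * L / A); split => //.
  by rewrite divr_ge0 ?mulr_ge0// ltW.
move=> d z1 z2 dh s1 s2.
have h0' : `|0 : R| <= 2^-1 by rewrite normr0; lra.
have [a1 a2 a3 a4] := stripP bh h4 dh h0 s1.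
have [b1 b2 b3 b4] := stripP h0' h4 dh h0 s2.
have zb : bidisc (of_coords (z1, z2)) by [].
split => //.
have zcb : closed_bidisc (of_coords (z1, z2)) by split; exact: ltW.
have arcb : closed_bidisc (upper_point b, upper_point 0 : C).
  have le1 x : `|x| <= 3 / 4 -> normc (upper_point x) <= 1.
    by move=> /normc_upper_point ->.
  by split; apply: le1; lra.
have [_ h1] := pK _ _ arcb zcb.
have D0 : dist1 (upper_point b, upper_point 0) (of_coords (z1, z2)) <= 8 * h.
  rewrite (_ : 8 * h = 4 * h + 4 * h); last lra.
  by apply: lerD; rewrite normc_sub_sym; [exact: a4|exact: b4].
have h2 := normc_sub_le
  (peval p (upper_point b, upper_point 0)) (peval p (of_coords (z1, z2))).
have KD : K * dist1 (upper_point b, upper_point 0) (of_coords (z1, z2)) <= A / 2.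
  apply: le_trans (ler_wpM2l K0 D0) _.
  have : h * (16 * (K + 1)) <= A by rewrite -ler_pdivlMr// mulr_gt0//; lra.
  lra.
have mp : A / 2 <= normc (peval p (of_coords (z1, z2))) by rewrite -/A in h2; lra.
have A20 : 0 < A / 2 by lra.
have := rL (of_coords (z1, z2))
  (upper_point z1.1, upper_point z2.1) _ zcb (conj a2 b2) A20 mp.
apply: le_trans; rewrite lerD2l lerN2.
have -> : 4 * L / A * d = L * (2 * d) / (A / 2) by field; rewrite gt_eqF.
rewrite ler_wpM2r ?invr_ge0 ?(ltW A20)// ler_wpM2l//.
rewrite (_ : 2 * d = d + d); last lra.
by apply: lerD; [exact: a3|exact: b3].
Qed.

(** On the product of two strips of width of order [1 / N], which has volume of
    order [N^(-2)], the modulus of [phi ^ N] stays bounded below. *)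
Lemma A2_sqnorm_quotient_power_ge (p : {poly {poly R[i]}}) tau (phi : C2 -> C) :
  pzeros p `&` torus (R := R) = [set tau] ->
  (forall z, bidisc z -> phi z = peval (reflection p) z / peval p z) ->
  exists2 c : R, 0 < c & forall N, (0 < N)%N ->
    ((c / N%:R ^+ 2)%:E <= A2_sqnorm (fun z => phi z ^+ N)%R)%E.
Proof.
move=> /torus_point_nonzero[b bh pb] phiE.
have [h [L [h0 h4 L0 hL]]] := quotient_near_arcs bh pb.
pose c0 := h ^+ 2 / (2 * (L + 1) * pi).
have c00 : 0 < c0.
  by rewrite divr_gt0 ?exprn_gt0// !mulr_gt0 ?pi_gt0//; lra.
exists (2^-1 * c0 ^+ 2) => [|N N0]; first by rewrite mulr_gt0 ?exprn_gt0.
have NR0 : 1 <= N%:R :> R by rewrite ler1n.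
have NR00 : 0 < N%:R :> R by rewrite ltr0n.
(* With this width, 2 N L d <= 1/2, which is what the Bernoulli inequality
   below needs. *)
pose d := h / (4 * N%:R * (L + 1)).
have dE : d * (4 * N%:R * (L + 1)) = h.
  by rewrite /d mulfVK// gt_eqF// !mulr_gt0//; lra.
have d0 : 0 < d by rewrite divr_gt0// !mulr_gt0//; lra.
have dh : d <= h by rewrite -dE ler_peMr ?ltW//; nra.
have Ld : L * d * (N%:R * 4) <= 1.
  have : L * d * (N%:R * 4) <= d * (4 * N%:R * (L + 1)).
    have : 0 <= d * (4 * N%:R) by apply: mulr_ge0; [exact: ltW|exact: mulr_ge0].
    lra.
  by rewrite dE; lra.
have H : (2^-1%:E * (dA (R:=R) \x dA (R:=R)) (strip b h d `*` strip 0 h d) <=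
    A2_sqnorm (fun z => phi z ^+ N)%R)%E.
  apply: ge_integral_indic => //.
  - by apply: measurableX; exact: measurable_strip.
  - by move=> [z1 z2] [s1 s2]; have [] := hL _ _ _ dh s1 s2.
  - by move=> w _; rewrite lee_fin sqr_ge0.
  move=> [z1 z2] [s1 s2]; have [zb zL] := hL _ _ _ dh s1 s2.
  rewrite lee_fin phiE// normcX -exprM.
  have Ld1 : 0 <= 1 - L * d.
    have : 0 <= L * d by rewrite mulr_ge0// ltW.
    nra.
  apply: (@le_trans _ _ ((1 - L * d) ^+ (N * 2))); last first.
    by apply: lerXn2r; rewrite ?nnegrE ?normc_ge0.
  apply: le_trans (bernoulli_le _ _); last by lra.
  by rewrite natrM; lra.
apply: le_trans H.
have ms := fun b => @measurable_strip R b h d.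
rewrite product_measure1E// -mulrA EFinM lee_wpmul2l//.
have volE (P : R) : P != 0 -> (h ^+ 2 / (2 * (L + 1) * P)) ^+ 2 / N%:R ^+ 2 =
    (2 * h * d / P) * (2 * h * d / P).
  by move=> P0; rewrite /d; field; rewrite P0 !gt_eqF//; lra.
rewrite {}volE ?gt_eqF ?pi_gt0//.
rewrite EFinM.
have q0 : 0 <= 2 * h * d / pi.
  apply: divr_ge0; last exact: pi_ge0.
  by apply: mulr_ge0; [apply: mulr_ge0|]; rewrite ?ltW.
by apply: lee_pmul; rewrite ?lee_fin//; apply: dA_strip_ge; exact: ltW.
Qed.

(** The exponents are chosen with [s = n^(-3)] and [N = 15 n^7]: the exceptional
    set has volume of order [s^5 = n^(-15)], which is smaller than [N^(-2)] by a
    factor of order [n], while [N s^2 = 15 n] is large enough for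
    [(1 - s^2) ^ N] to be at most [n^(-15)]. *)
Lemma A2_sqnorm_midpoint_power_decay (n : nat) : (1 < n)%N ->
  (A2_sqnorm (@midpoint_power R (15 * n ^ 7)) <= (2064 / n%:R ^+ 15)%:E)%E.
Proof.
move=> n1; have n2 : 2 <= n%:R :> R by rewrite (ler_nat _ 2).
have n0 : 0 < n%:R :> R by lra.
pose s : R := (n%:R ^+ 3)^-1.
have s0 : 0 < s by rewrite invr_gt0 exprn_gt0.
have s2 : s <= 2^-1.
  by rewrite lef_pV2 ?posrE ?exprn_gt0//; nra.
apply: le_trans (A2_sqnorm_midpoint_power_le _ s0 s2) _; rewrite lee_fin.
have -> : s ^+ 5 = (n%:R ^+ 15)^-1 by rewrite exprVn -exprM.
suff : (1 - s ^+ 2) ^+ (15 * n ^ 7) <= (n%:R ^+ 15)^-1 by lra.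
have s21 : 0 <= 1 - s ^+ 2 by nra.
(* (1 - s^2) (1 + s^2) <= 1 turns the claim into a lower bound for the power of
   1 + s^2, obtained by raising the Bernoulli inequality with exponent n^7 to the
   power 15. *)
have big : n%:R ^+ 15 <= (1 + s ^+ 2) ^+ (15 * n ^ 7).
  rewrite mulnC exprM; apply: lerXn2r; rewrite ?nnegrE ?exprn_ge0//; try nra.
  apply: le_trans (bernoulli_le _ _); last by nra.
  have -> : (n ^ 7)%:R * s ^+ 2 = n%:R :> R.
    by rewrite natrX /s; field; rewrite gt_eqF.
  lra.
have p0 : 0 < n%:R ^+ 15 :> R by rewrite exprn_gt0.
rewrite -[leRHS]mul1r ler_pdivlMr//.
apply: le_trans (ler_wpM2l (exprn_ge0 _ s21) big) _.
by rewrite -exprMn exprn_ile1//; nra.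
Qed.

End main.

Theorem theorem2p1 (R : realType) (phi : R[i]^o * R[i]^o -> R[i]^o)
    (p : {poly {poly R[i]}}) (tau : R[i]^o * R[i]^o)
    (q C : R) (U : set (R[i]^o * R[i]^o)) :
  rational_inner phi ->
  (forall z, bidisc z -> phi z = peval (reflection p) z / peval p z) ->
  (forall z, bidisc z -> peval p z != 0) ->
  pzeros p `&` torus (R := R) = [set tau] ->
  1 < q -> 0 < C -> nbhs tau U ->
  (forall z, closure (bidisc (R := R) `&` U) z ->
    C * edist2_set z (pzeros p) `^ q <= normc (peval p z)) ->
  ~ bounded_on_A2 (comp_op (fun z => (phi z, phi z))).
Proof.
move=> _ phiE _ ptau _ _ _ _ [A2T _ [M TM]].
have [c c0 clow] := A2_sqnorm_quotient_power_ge ptau phiE.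
(* 225 is the square of the factor 15 in N, and 2064 is the constant of the
   upper bound. *)
pose X := 225 * 2064 * M ^+ 2 / c.
have X0 : 0 <= X.
  apply: divr_ge0; last exact: ltW.
  by apply: mulr_ge0; [lra|exact: sqr_ge0].
pose n := (Num.bound X).+2.
have nX : X < n%:R.
  apply: lt_le_trans (archi_boundP X0) _.
  by rewrite ler_nat; exact: leq_trans (leqnSn _) (leqnSn _).
have n0 : 0 < n%:R :> R by rewrite ltr0n.
pose N := (15 * n ^ 7)%N.
have up := A2_sqnorm_midpoint_power_decay R (isT : (1 < n)%N).
have N0 : (0 < N)%N by rewrite muln_gt0 expn_gt0.
have low := clow N N0.
have fA2 : A2 (@midpoint_power R N).
  split; first by move=> z _; exact: differentiable_midpoint_power.
  by apply: le_lt_trans up _; rewrite ltry.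
have TE : comp_op (fun z => (phi z, phi z)) (@midpoint_power R N) =
    (fun z => phi z ^+ N).
  apply/funext => z; rewrite /comp_op /midpoint_power/=; congr (_ ^+ _).
  have midxx (x : R[i]) : (x + x) / 2 = x by field.
  exact: midxx.
have [_ Tfin] := A2T _ fA2; have := TM _ fA2.
have sq_ge0 f : (0 <= A2_sqnorm (R := R) f)%E.
  by apply: integral_ge0 => w _; rewrite lee_fin sqr_ge0.
have upfin := le_lt_trans up (ltry _).
rewrite TE in Tfin *; rewrite /A2_norm.
move: low up Tfin upfin (sq_ge0 (fun z => phi z ^+ N)) (sq_ge0 (@midpoint_power R N)).
rewrite -/N; move: (A2_sqnorm (fun z => phi z ^+ N)) (A2_sqnorm (@midpoint_power R N)).
move=> [a| |] [b| |]//=; rewrite !lee_fin => low up _ _ a0 b0 ab.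
have aM : a <= M ^+ 2 * b.
  rewrite -(sqr_sqrtr a0) -(sqr_sqrtr b0) -exprMn.
  apply: lerXn2r => //; rewrite nnegrE ?sqrtr_ge0//.
  exact: le_trans (sqrtr_ge0 _) ab.
have : c / N%:R ^+ 2 <= M ^+ 2 * (2064 / n%:R ^+ 15).
  apply: le_trans low _; apply: le_trans aM _; apply: ler_wpM2l => //.
  exact: sqr_ge0.
have -> : c / N%:R ^+ 2 = c * n%:R / 225 / n%:R ^+ 15.
  by rewrite /N natrM natrX; field; rewrite gt_eqF.
rewrite mulrA ler_pM2r ?invr_gt0 ?exprn_gt0//.
move: nX; rewrite ltr_pdivrMr//; lra.
Qed.
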